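(* Let $t < n/2$. Then \[\mathrm{Span}\{ 1_{\mathcal{F}_T} \in \mathbb{R}[\mathcal{M}_{2n}] : T \text{ a set of } t \text{ pairwise disjoint edges of } K_{2n} \} \subseteq U_t,\] where $\mathcal{F}_T = \{m \in \mathcal{M}_{2n} : T \subseteq m\}$ and $1_{\mathcal{F}_T}$ is its characteristic function.
   Context: $\mathcal{M}_{2n}$ is the set of perfect matchings of the complete graph $K_{2n}$ on $[2n]$; $S_{2n}$ acts on $\mathcal{M}_{2n}$ by $\sigma m = \{\{\sigma(a),\sigma(b)\} : \{a,b\} \in m\}$. Let $m^* = \{\{1,2\},\{3,4\},\dots,\{2n-1,2n\}\}$. For $f \in \mathbb{R}[\mathcal{M}_{2n}]$ (real functions on $\mathcal{M}_{2n}$) define its lift $\tilde f \in \mathbb{R}[S_{2n}]$ by $\tilde f(\sigma) = f(\sigma m^* )$, and for an irreducible representation $\rho$ of $S_{2n}$ define the Fourier transform $\hat f(\rho) = \frac{1}{(2n)!}\sum_{\sigma \in S_{2n}} \tilde f(\sigma)\rho(\sigma)$. Irreducible representations of $S_{2n}$ are indexed by partitions of $2n$. Partitions of the same integer are ordered reverse-lexicographically: $\mu \leq \lambda$ iff $\mu = \lambda$ or $\mu_j < \lambda_j$ at the first index $j$ where they differ. For $\lambda=(\lambda_1,\dots,\lambda_k)$, $2\lambda = (2\lambda_1,\dots,2\lambda_k)$; in particular $2(n-t,1^t) = (2(n-t),2,\dots,2)$ with $t$ parts equal to $2$. Define $U_t = \{ f \in \mathbb{R}[\mathcal{M}_{2n}]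 : \hat f(\rho) = 0 \text{ for every irreducible } \rho \vdash 2n \text{ with } \rho < 2(n-t,1^t)\}$. *)

(* Defs.v *)
From HB Require Import structures.
From mathcomp Require Import all_boot all_order all_fingroup all_algebra.
Set Implicit Arguments. Unset Strict Implicit. Unset Printing Implicit Defensive.
Import Order.TTheory GRing.Theory Num.Theory.
Local Open Scope ring_scope.

Definition is_pm (n : nat) (m : {set {set 'I_(2 * n)}}) : bool :=
  partition m [set: 'I_(2 * n)] && [forall e in m, #|e| == 2%N].

Definition pm_act (n : nat) (s : {perm 'I_(2 * n)}) (m : {set {set 'I_(2 * n)}})
  : {set {set 'I_(2 * n)}} := [set (s @: e) | e : {set 'I_(2 * n)} in m].

(* m* = {{1,2},{3,4},...,{2n-1,2n}} (0-based: the i-th block is {2i, 2i+1} = {x | x/2 = i}) *)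
Definition mstar (n : nat) : {set {set 'I_(2 * n)}} :=
  [set [set x : 'I_(2 * n) | x./2 == i] | i : 'I_n].

(* functions on M_{2n} are represented as functions on {set {set 'I_(2n)}};
   only their values on perfect matchings are ever used. *)
Definition lift (R : Type) (n : nat) (f : {set {set 'I_(2 * n)}} -> R)
  (s : {perm 'I_(2 * n)}) : R := f (pm_act s (mstar n)).

Definition disjoint_edges (n t : nat) (T : {set {set 'I_(2 * n)}}) : bool :=
  [&& #|T| == t, [forall e in T, #|e| == 2%N] & trivIset T].

Definition ind_FT (R : pzRingType) (n : nat) (T : {set {set 'I_(2 * n)}})
  (m : {set {set 'I_(2 * n)}}) : R :=
  ((is_pm m && (T \subset m)) : nat)%:R.

Definition is_partition (N : nat) (la : seq nat) : bool :=
  [&& sorted geq la, all (fun x => 0 < x)%N la & sumn la == N].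

Definition rlex_lt (mu la : seq nat) : Prop :=
  exists j : nat, (forall i, (i < j)%N -> nth 0%N mu i = nth 0%N la i)
                  /\ (nth 0%N mu j < nth 0%N la j)%N.

Definition hook2 (n t : nat) : seq nat := (2 * (n - t))%N :: nseq t 2%N.

Definition cells (la : seq nat) : seq (nat * nat) :=
  flatten [seq [seq (i, c) | c <- iota 0 (nth 0%N la i)] | i <- iota 0 (size la)].

Definition cell_row (la : seq nat) (j : nat) : nat := (nth (0, 0)%N (cells la) j).1.
Definition cell_col (la : seq nat) (j : nat) : nat := (nth (0, 0)%N (cells la) j).2.

(* A tableau of shape la (a partition of N) is encoded by s : {perm 'I_N}:
   the j-th cell (in row-by-row order) contains the entry s j.
   A tabloid is encoded by its row function 'I_N -> nat (entry |-> row). *)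
Definition tabloid_of (N : nat) (la : seq nat) (s : {perm 'I_N})
  : {ffun 'I_N -> nat} := [ffun x => cell_row la ((s^-1)%g x)].

Definition col_stab (N : nat) (la : seq nat) (s : {perm 'I_N}) (p : {perm 'I_N})
  : bool := [forall x, cell_col la ((s^-1)%g (p x)) == cell_col la ((s^-1)%g x)].

(* vectors of the permutation module M^la: real functions on tabloids *)
(* polytabloid e_s = sum_{p in C_s} sgn(p) {p o s}; note (s * p)%g = p o s in MathComp *)
Definition polytabloid (R : pzRingType) (N : nat) (la : seq nat) (s : {perm 'I_N})
  : {ffun 'I_N -> nat} -> R :=
  fun T => \sum_(p : {perm 'I_N} | col_stab la s p)
             (-1) ^+ (odd_perm p) * ((T == tabloid_of la (s * p)%g) : nat)%:R.

(* action of S_N on M^la: (tau . v)(T) = v(tau^-1 . T), where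
   (tau^-1 . T)(x) = T(tau x) *)
Definition perm_act (R : Type) (N : nat) (tau : {perm 'I_N})
  (v : {ffun 'I_N -> nat} -> R) : {ffun 'I_N -> nat} -> R :=
  fun T => v [ffun x => T (tau x)].

(* The Fourier transform hat f(rho_la) = 1/N! sum_tau f~(tau) rho_la(tau),
   where rho_la is the Specht-module representation S^la = span of the
   polytabloids; we give its value on the spanning vector e_s. *)
Definition fourier_on (R : fieldType) (n : nat) (f : {set {set 'I_(2 * n)}} -> R)
  (la : seq nat) (s : {perm 'I_(2 * n)}) : {ffun 'I_(2 * n) -> nat} -> R :=
  fun T => ((2 * n)`!%:R)^-1 *
    \sum_(tau : {perm 'I_(2 * n)}) lift f tau * perm_act tau (polytabloid R la s) T.

(* hat f(rho_la) = 0 : the operator vanishes on all of S^la, i.e. on every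
   polytabloid (these span S^la). *)
Definition fourier_zero (R : fieldType) (n : nat) (f : {set {set 'I_(2 * n)}} -> R)
  (la : seq nat) : Prop :=
  forall (s : {perm 'I_(2 * n)}) (T : {ffun 'I_(2 * n) -> nat}), fourier_on f la s T = 0.

Definition in_U (R : fieldType) (n t : nat) (f : {set {set 'I_(2 * n)}} -> R) : Prop :=
  forall la : seq nat, is_partition (2 * n) la -> rlex_lt la (hook2 n t) ->
    fourier_zero f la.

(* Main.v *)
(** Averaging over the Young subgroup [H] that preserves every edge of [T] and
    the set of uncovered points does not change the lift of [ind_FT T].  Hence the Fourier
    transform kills a polytabloid as soon as, in every tableau of the shape
    [la], two points of the same [H]-orbit share a column: the transposition
    of these points lies in [H] and negates the polytabloid.  If no such pair
    existed, the uncovered points would fill the first row's worth of columns,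
    forcing the edges of [T] into the first two columns, and the second column would
    be too long for a shape below [2(n-t,1^t)]. *)
Require Import Defs.
From HB Require Import structures.
From mathcomp Require Import all_boot all_order all_fingroup all_algebra.
From mathcomp Require Import zify.
Set Implicit Arguments. Unset Strict Implicit. Unset Printing Implicit Defensive.
Import Order.TTheory GRing.Theory Num.Theory.
Local Open Scope ring_scope.

(** * Cells of a Young diagram, with rows and columns numbered from 0 *)

Section Cells.
Local Open Scope nat_scope.
Implicit Types (la : seq nat) (i j N : nat).

Lemma cells_allpairs la :
  cells la = [seq (i, c) | i <- iota 0 (size la), c <- iota 0 (nth 0 la i)].
Proof. by []. Qed.

Lemma size_cells la : size (cells la) = sumn la.
Proof.
rewrite cells_allpairs size_allpairs_dep.
under eq_map => i do rewrite size_iota.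
by rewrite -/(mkseq (nth 0 la) (size la)) mkseq_nth.
Qed.

Lemma cells_uniq la : uniq (cells la).
Proof.
rewrite cells_allpairs; apply: allpairs_uniq_dep; first exact: iota_uniq.
  by move=> i _; apply: iota_uniq.
by move=> [i c] [k d] _ _ /= [-> ->].
Qed.

Lemma cell_col_lt la j : j < sumn la -> cell_col la j < nth 0 la (cell_row la j).
Proof.
rewrite -size_cells /cell_col /cell_row => /(mem_nth (0, 0)).
move: (nth _ _ _) => p; rewrite cells_allpairs.
by case/allpairsPdep=> i [c] [_]; rewrite mem_iota => /andP[_ c_lt] ->.
Qed.

Lemma cell_inj la i j : i < sumn la -> j < sumn la ->
  cell_row la i = cell_row la j -> cell_col la i = cell_col la j -> i = j.
Proof.
rewrite -size_cells => lti ltj eq_row eq_col.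
apply/eqP; rewrite -(nth_uniq (0, 0) lti ltj (cells_uniq la)).
move: eq_row eq_col; rewrite /cell_row /cell_col.
by case: (nth _ _ i) (nth _ _ j) => [a b] [a' b'] /= -> ->.
Qed.

Lemma sorted_geq_nth la i j : sorted geq la -> i <= j -> nth 0 la j <= nth 0 la i.
Proof.
move=> la_sorted le_ij; have [lt_j|ge_j] := ltnP j (size la); last first.
  by rewrite (nth_default _ ge_j).
have geq_trans : transitive geq by move=> a b c ba ac; apply: leq_trans ac ba.
apply: (sorted_leq_nth geq_trans leqnn 0 la_sorted) => //.
by rewrite inE (leq_ltn_trans le_ij lt_j).
Qed.

End Cells.

(** * Blocks cut out by the edges of [T], and column collisions *)

Section EdgeBlocks.
Local Open Scope nat_scope.
Variables (n t : nat) (T : {set {set 'I_(2 * n)}}).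
Hypothesis dT : disjoint_edges t T.

Lemma card_cover_edges : #|cover T| = t * 2.
Proof.
case/and3P: dT => /eqP <- /forall_inP cardT /eqP <-.
by rewrite (eq_bigr (fun=> 2)) ?sum_nat_const // => e /cardT /eqP.
Qed.

(** The default value of [pblock] makes the uncovered points one common block, so [pblock T] alone
    encodes all orbits of the Young subgroup. *)
Lemma pblock_notin_cover (x : 'I_(2 * n)) : x \notin cover T -> pblock T x = set0.
Proof.
move=> xT; rewrite /pblock; case: pickP => //= B /andP[BT xB].
by case/negP: xT; apply/bigcupP; exists B.
Qed.

Lemma set0_notin_edges : set0 \notin T.
Proof.
case/and3P: dT => _ /forall_inP cardT _; apply/negP => /cardT.
by rewrite cards0.
Qed.

(** Without a collision each of the [t] edges, and also the block of uncovered points, would have a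
    point in column 1; the bound on [la] leaves at most [t] cells there. *)
Lemma column_collision (la : seq nat) (u : {perm 'I_(2 * n)}) :
    t < n -> is_partition (2 * n) la -> rlex_lt la (hook2 n t) ->
  exists x y, [/\ x != y, pblock T x = pblock T y
                & cell_col la (u x) = cell_col la (u y)].
Proof.
move=> lt_tn /and3P[la_sorted _ /eqP sum_la] [j [la_eq la_lt]].
have usum x : u x < sumn la by rewrite sum_la.
pose col x := cell_col la (u x); pose row x := cell_row la (u x).
have col_lt x : col x < nth 0 la (row x) by apply: cell_col_lt.
have rc_inj x y : row x = row y -> col x = col y -> x = y.
  by move=> eqr eqc; apply: (@perm_inj _ u); apply: val_inj; apply: cell_inj eqr eqc.
case: (boolP [exists x, exists y,
    [&& x != y, pblock T x == pblock T y & col x == col y]]).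
  case/existsP=> x /existsP[y /and3P[nxy /eqP eqb /eqP eqc]].
  by exists x, y; split.
move=> no_coll; exfalso.
have col_inj x y : pblock T x = pblock T y -> col x = col y -> x = y.
  move=> eqb eqc; apply: contraNeq no_coll => nxy.
  by apply/existsP; exists x; apply/existsP; exists y; rewrite nxy eqb eqc !eqxx.
pose B0 := ~: cover T.
have B0P x : x \in B0 -> pblock T x = set0.
  by rewrite inE; apply: pblock_notin_cover.
have card_B0 : #|B0| = 2 * (n - t).
  by rewrite cardsCs setCK card_ord card_cover_edges; lia.
have uniq_cols : uniq [seq col x | x <- enum B0].
  rewrite map_inj_in_uniq ?enum_uniq // => x y; rewrite !mem_enum => xB yB.
  by apply: col_inj; rewrite !B0P.
have sub_cols : {subset [seq col x | x <- enum B0] <= iota 0 (nth 0 la 0)}.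
  move=> _ /mapP[x _ ->]; rewrite mem_iota /= add0n.
  exact: leq_trans (col_lt x) (sorted_geq_nth la_sorted _).
have size_cols : size [seq col x | x <- enum B0] = 2 * (n - t).
  by rewrite size_map -cardE.
have la0_ge : 2 * (n - t) <= nth 0 la 0.
  by rewrite -size_cols -[leqRHS](size_iota 0) uniq_leq_size.
(* The first row is too long for the first difference to occur at index 0. *)
case: j la_eq la_lt => [|j] la_eq la_lt; first by rewrite ltnNge la0_ge in la_lt.
have la0 : nth 0 la 0 = 2 * (n - t) by rewrite la_eq.
(* The uncovered points occupy [2 * (n - t)] distinct columns out of exactly that many. *)
have B0_col c : c < nth 0 la 0 -> exists2 z, z \in B0 & col z = c.
  move=> lt_c; have [|_ eq_cols] := uniq_min_size uniq_cols sub_cols.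
    by rewrite size_iota size_cols la0.
  have : c \in iota 0 (nth 0 la 0) by rewrite mem_iota.
  by rewrite -eq_cols => /mapP[z]; rewrite mem_enum => zB ->; exists z.
rewrite /= nth_nseq in la_lt.
(* Beyond its last part [hook2 n t] reads as 0, and no part of [la] is below 0. *)
have lt_jt : j < t by move: la_lt; case: ifP.
have {}la_lt : nth 0 la j.+1 < 2 by move: la_lt; rewrite lt_jt.
have la1 : nth 0 la 1 <= 2.
  case: j la_eq la_lt {lt_jt} => [_ /ltnW //|j la_eq _].
  by rewrite la_eq //= nth_nseq; case: ifP.
have row_big x : 2 <= col x -> row x = 0.
  move=> ge2; apply/eqP; rewrite -leqn0 leqNgt; apply/negP => row_gt0.
  have := leq_trans (col_lt x) (sorted_geq_nth la_sorted row_gt0).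
  by move/leq_trans/(_ la1); rewrite ltnNge ge2.
pose X := [set x | col x == 1].
(* Row [j.+1] is too short to reach column 1, so only rows 0 to [j] do, and [j < t]. *)
have card_X : #|X| <= t.
  rewrite cardE -(size_map row) -[leqRHS](size_iota 0); apply: uniq_leq_size.
    rewrite map_inj_in_uniq ?enum_uniq // => x y; rewrite !mem_enum !inE.
    by move=> /eqP cx /eqP cy eqr; apply: rc_inj; rewrite // cx cy.
  move=> r /mapP[x]; rewrite mem_enum inE => /eqP cx ->.
  rewrite mem_iota /= add0n (leq_trans _ lt_jt) // ltnS leqNgt.
  apply/negP => lt_j; have := leq_trans (col_lt x) (sorted_geq_nth la_sorted lt_j).
  by rewrite cx => /leq_trans/(_ la_lt).
(* From column 2 on, a column is a single cell of row 0, already filled by an uncovered point. *)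
have col_edge x : x \in cover T -> col x < 2.
  move=> xT; rewrite ltnNge; apply/negP => ge2.
  have [|z zB eqc] := B0_col (col x).
    exact: leq_trans (col_lt x) (sorted_geq_nth la_sorted _).
  have eqzx : z = x by apply: rc_inj; rewrite // !row_big ?eqc.
  by move: zB; rewrite eqzx inE xT.
(* The two points of an edge fill columns 0 and 1 in some order; [set0] stands for the uncovered
   points, which meet every column. *)
have sub_blocks : set0 |: T \subset [set pblock T x | x in X].
  apply/subsetP => B; case/setU1P => [-> | BT].
    have [|z zB cz] := B0_col 1; first by rewrite la0; lia.
    by apply/imsetP; exists z; rewrite ?inE ?cz ?B0P.
  case/and3P: dT => _ /forall_inP/(_ B BT)/cards2P[x [y [nxy defB]]] trivT.
  have inB z : z \in B -> pblock T z = B /\ col z < 2.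
    move=> zB; split; first exact: def_pblock.
    by apply: col_edge; apply/bigcupP; exists B.
  have [|bx cx] := inB x; first by rewrite defB !inE eqxx.
  have [|b_y cy] := inB y; first by rewrite defB !inE eqxx orbT.
  have [cx1|cx1] := eqVneq (col x) 1.
    by apply/imsetP; exists x; rewrite ?inE ?cx1.
  apply/imsetP; exists y; rewrite ?inE //.
  apply: contraNT nxy => cy1; apply/eqP/col_inj; rewrite ?bx //.
  by move: cx cy cx1 cy1; lia.
have := leq_trans (subset_leq_card sub_blocks) (leq_imset_card _ _).
rewrite cardsU1 set0_notin_edges; case/and3P: dT => /eqP -> _ _.
by move/leq_trans/(_ card_X); rewrite ltnn.
Qed.

End EdgeBlocks.

(** * Young subgroups, antisymmetry of polytabloids, and averaging *)

Definition block_stab (I : finType) (B : eqType) (b : I -> B) : {set {perm I}} :=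
  [set g : {perm I} | [forall x, b (g x) == b x]].

Lemma block_stabP (I : finType) (B : eqType) (b : I -> B) (g : {perm I}) :
  reflect (forall x, b (g x) = b x) (g \in block_stab b).
Proof. by rewrite inE; apply: (iffP forallP) => bg x; apply/eqP. Qed.

Lemma block_stab1 (I : finType) (B : eqType) (b : I -> B) : 1%g \in block_stab b.
Proof. by apply/block_stabP => x; rewrite perm1. Qed.

Lemma block_stab_tperm (I : finType) (B : eqType) (b : I -> B) (x y : I) :
  b x = b y -> tperm x y \in block_stab b.
Proof. by move=> bxy; apply/block_stabP => z; case: tpermP => [->|->|//]. Qed.

Lemma block_stabMl (I : finType) (B : eqType) (b : I -> B) (g h : {perm I}) :
  g \in block_stab b -> ((g * h)%g \in block_stab b) = (h \in block_stab b).
Proof.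
move/block_stabP=> bg; apply/block_stabP/block_stabP => bh x.
  by rewrite -[x](permKV g) -permM bh bg.
by rewrite permM bh bg.
Qed.

(** Translation by [q^-1] permutes the column stabiliser and flips every sign in the defining
    sum. *)
Lemma polytabloid_odd (R : comPzRingType) (N : nat) (la : seq nat)
    (s q : {perm 'I_N}) (S : {ffun 'I_N -> nat}) :
    col_stab la s q -> odd_perm q ->
  polytabloid R la s [ffun x => S (q x)] = - polytabloid R la s S.
Proof.
move=> /forallP qs q_odd; rewrite /polytabloid -sumrN.
rewrite (reindex_inj (mulIg q^-1%g)) /=; apply: eq_big => [p|p _].
  apply/forallP/forallP => ps x.
    by have:= qs (((p * q^-1)%g) x); rewrite (eqP (ps x)) permM permKV.
  by have:= qs (((p * q^-1)%g) x); rewrite permM permKV eq_sym (eqP (ps x)).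
rewrite odd_permM odd_permV q_odd addbT signrN mulNr; congr (- (_ * (_%:R))).
congr (nat_of_bool _); apply/eqP/eqP => [/ffunP eqS | ->]; apply/ffunP => x.
  have := eqS (q^-1%g x); rewrite !ffunE permKV => ->.
  by rewrite !invMg !permM invgK permKV.
by rewrite !ffunE !invMg !permM invgK.
Qed.

(** Multiplied by the order of the stabiliser, the sum becomes one of [f u] times the inner sum of
    [F (u * h)] over [h]; translating [h] by [g] shows that this inner sum equals its own
    negative. *)
Lemma sum_stab_antisym_eq0 (R : numDomainType) (I : finType) (B : eqType)
    (b : I -> B) (f F : {perm I} -> R) :
    (forall u h, h \in block_stab b -> f (u * h)%g = f u) ->
    (forall u, exists2 g, g \in block_stab b &
       forall h, F (u * (g * h))%g = - F (u * h)%g) ->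
  \sum_u f u * F u = 0.
Proof.
move=> f_inv F_anti; pose H := block_stab b.
have H_neq0 : (#|H|)%:R != 0 :> R.
  by rewrite pnatr_eq0 -lt0n; apply/card_gt0P; exists 1%g; apply: block_stab1.
apply: (mulfI H_neq0); rewrite mulr0 mulr_natl -sumr_const.
transitivity (\sum_(h in H) \sum_u f u * F (u * h)%g).
  apply: eq_bigr => h hH; rewrite (reindex_inj (mulIg h)).
  by apply: eq_bigr => u _; rewrite f_inv.
rewrite exchange_big big1 // => u _; rewrite -mulr_sumr.
have [g gH gF] := F_anti u; set S := \sum_(h in H) _.
suff /esym/eqP : S = - S by rewrite eqNr => /eqP ->; rewrite mulr0.
rewrite {1}/S (reindex_inj (mulgI g)) -sumrN.
by apply: eq_big => h; rewrite ?(block_stabMl _ gH) ?gF.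
Qed.

(** * The action on matchings, and vanishing of the transform *)

Lemma pm_actM (n : nat) (s g : {perm 'I_(2 * n)}) m :
  pm_act (s * g)%g m = pm_act g (pm_act s m).
Proof.
rewrite /pm_act -imset_comp; apply: eq_imset => e /=.
by rewrite -imset_comp; apply: eq_imset => x; rewrite /= permM.
Qed.

Lemma is_pm_act (n : nat) (g : {perm 'I_(2 * n)}) m :
  is_pm (pm_act g m) = is_pm m.
Proof.
have gT : g @: [set: 'I_(2 * n)] = [set: 'I_(2 * n)].
  by apply/eqP; rewrite eqEcard subsetT card_imset ?leqnn //; apply: perm_inj.
rewrite /is_pm -{1}gT imset_partition; last exact: perm_inj.
congr (_ && _); apply/forall_inP/forall_inP => card_m e.
  by move=> em; have := card_m _ (imset_f _ em); rewrite card_imset //; apply: perm_inj.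
by case/imsetP=> d dm ->; rewrite card_imset ?card_m //; apply: perm_inj.
Qed.

Lemma imset_block_stab (n : nat) (T : {set {set 'I_(2 * n)}}) g e :
  trivIset T -> g \in block_stab (pblock T) -> e \in T -> g @: e = e.
Proof.
move=> trivT /block_stabP gT eT; apply/eqP.
rewrite eqEcard card_imset ?leqnn ?andbT; last exact: perm_inj.
apply/subsetP => _ /imsetP[x xe ->].
have gx : pblock T (g x) = e by rewrite gT; apply: def_pblock.
(* If [g x] were uncovered, its block [e] would be [set0], yet [e] contains [x]. *)
rewrite -gx mem_pblock -[_ \in _]negbK; apply/negP => /pblock_notin_cover.
by rewrite gx => e0; rewrite e0 inE in xe.
Qed.

Lemma ind_FT_act (R : pzRingType) (n : nat) (T m : {set {set 'I_(2 * n)}}) g :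
  trivIset T -> g \in block_stab (pblock T) ->
  ind_FT R T (pm_act g m) = ind_FT R T m.
Proof.
move=> trivT gT; rewrite /ind_FT is_pm_act; congr (_ && _)%:R.
have fixT e := @imset_block_stab _ T g e trivT gT.
apply/subsetP/subsetP => sTm e eT.
  have /imsetP[d dm] := sTm e eT.
  by rewrite -{1}(fixT e eT) => /(imset_inj (@perm_inj _ g)) ->.
by rewrite -(fixT e eT); apply/imset_f/sTm.
Qed.

Lemma sum_ind_FT_polytabloid (R : realFieldType) (n t : nat)
    (T : {set {set 'I_(2 * n)}}) (la : seq nat) (s : {perm 'I_(2 * n)})
    (S : {ffun 'I_(2 * n) -> nat}) :
    (t < n)%N -> disjoint_edges t T -> is_partition (2 * n) la ->
    rlex_lt la (hook2 n t) ->
  \sum_u Defs.lift (ind_FT R T) u * perm_act u (polytabloid R la s) S = 0.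
Proof.
move=> lt_tn dT la_part la_lt; have /and3P[_ _ trivT] := dT.
apply: (sum_stab_antisym_eq0 (b := pblock T)) => [u h hT | u].
  by rewrite /Defs.lift pm_actM ind_FT_act.
(* The collision is sought in the tableau [s * u], where the entry [x] sits in cell
   [(s * u)^-1 x]. *)
have [x [y [nxy bxy cxy]]] :=
  column_collision dT (s * u)^-1%g lt_tn la_part la_lt.
exists (tperm x y) => [|h]; first exact: block_stab_tperm.
rewrite !invMg !permM in cxy.
(* Conjugating by [u] turns a transposition within a column of [s * u] into one within a column of
   [s], where the polytabloid is antisymmetric. *)
pose q := tperm (u^-1%g x) (u^-1%g y).
have quE : (u * tperm x y = q * u)%g.
  by rewrite /q -tpermJ conjgE invgK !mulgA mulgKV.
rewrite mulgA quE -mulgA /perm_act.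
rewrite -(polytabloid_odd _ (q := q)).
- by congr polytabloid; apply/ffunP => z; rewrite !ffunE permM.
- by apply/forallP => z; rewrite /q; case: tpermP => [->|->|//]; rewrite cxy.
- by rewrite odd_tperm (inj_eq perm_inj).
Qed.

Theorem mainTheorem2 (R : realFieldType) (n t : nat) (ht : (2 * t < n)%N)
  (c : {set {set 'I_(2 * n)}} -> R) :
  in_U t (fun m : {set {set 'I_(2 * n)}} =>
            \sum_(T : {set {set 'I_(2 * n)}} | disjoint_edges t T) c T * ind_FT R T m).
Proof.
move=> la la_part la_lt s S; rewrite /fourier_on.
have lt_tn : (t < n)%N by apply: leq_ltn_trans ht; rewrite leq_pmull.
under eq_bigr => u _ do rewrite /Defs.lift mulr_suml.
rewrite exchange_big big1 ?mulr0 //= => T dT.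
under eq_bigr => u _ do rewrite -mulrA.
by rewrite -mulr_sumr (@sum_ind_FT_polytabloid _ _ t) ?mulr0.
Qed.
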